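(* There is no exotic coBUG with a connected component isomorphic to $K_{1,7}$.
   Context: All graphs are finite, simple, undirected, with nonempty vertex set. For distinct vertices $v,w$ of a connected graph $G$, let $\sigma_{vw}$ be the number of shortest paths between $v$ and $w$, and $\sigma_{vw}(x)$ the number of those containing $x$ as an internal vertex (so $\sigma_{vw}(x)=0$ if $x\in\{v,w\}$). The betweenness of a vertex $x$ is $B_G(x)=\sum_{\{v,w\}\subseteq V(G)}\frac{\sigma_{vw}(x)}{\sigma_{vw}}$, the sum being over unordered pairs of distinct vertices. A betweenness-uniform graph (BUG) is a connected graph $G$ in which all vertices have the same betweenness; this common value is the betweenness of $G$. A low-betweenness BUG is a BUG with betweenness smaller than $1$. Stars are the graphs $K_{1,\ell}$ with $\ell\ge 0$ ($K_{1,0}$ is the single-vertex graph). An exotic BUG is a low-betweenness BUG whose complement is not a disjoint union of stars of the same size (i.e. there is no $\ell\ge0$ such that every connected component of the complement is isomorphic to $K_{1,\ell}$). An exotic coBUG is the complement of an exotic BUG. *)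

(* Defs.v *)
From HB Require Import structures.
From mathcomp Require Import all_boot all_order all_algebra.

Set Implicit Arguments.
Unset Strict Implicit.
Unset Printing Implicit Defensive.

Import Order.TTheory GRing.Theory Num.Theory.

Record sgraph := SGraph {
  vertex :> finType;
  adj : rel vertex;
  adj_sym : symmetric adj;
  adj_irrefl : irreflexive adj;
  vertex_gt0 : 0 < #|vertex| }.

Arguments adj {s} x y.
Arguments SGraph {vertex} adj _ _ _.

Definition isomorphic (G H : sgraph) : Prop :=
  exists2 f : G -> H, bijective f & forall x y, adj (f x) (f y) = adj x y.

Definition connected (G : sgraph) : Prop :=
  forall x y : G, connect (@adj G) x y.

Section Complement.
Variable G : sgraph.

Definition compl_adj : rel G := fun x y => (x != y) && ~~ adj x y.

Lemma compl_adj_sym : symmetric compl_adj.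
Proof. by move=> x y; rewrite /compl_adj eq_sym adj_sym. Qed.

Lemma compl_adj_irrefl : irreflexive compl_adj.
Proof. by move=> x; rewrite /compl_adj eqxx. Qed.

Definition compl : sgraph :=
  SGraph compl_adj compl_adj_sym compl_adj_irrefl (vertex_gt0 G).

End Complement.

Section Component.
Variables (G : sgraph) (x : G).

Definition component_vertex : finType := {y : G | connect (@adj G) x y}.

Definition component_adj : rel component_vertex :=
  fun y z => adj (val y) (val z).

Lemma component_adj_sym : symmetric component_adj.
Proof. by move=> y z; apply: adj_sym. Qed.

Lemma component_adj_irrefl : irreflexive component_adj.
Proof. by move=> y; apply: adj_irrefl. Qed.

Lemma component_gt0 : 0 < #|component_vertex|.
Proof.
by apply/card_gt0P; exists (exist _ x (connect0 _ x) : component_vertex).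
Qed.

(* The connected component containing x, as an induced subgraph; every
   component of G arises in this way. *)
Definition component : sgraph :=
  SGraph component_adj component_adj_sym component_adj_irrefl component_gt0.

End Component.

Section Star.
Variable l : nat.

(* K_{1,l}: the centre is None and the leaves are the Some i. *)
Definition star_adj : rel (option 'I_l) := fun x y => isSome x != isSome y.

Lemma star_adj_sym : symmetric star_adj.
Proof. by move=> x y; rewrite /star_adj eq_sym. Qed.

Lemma star_adj_irrefl : irreflexive star_adj.
Proof. by move=> x; rewrite /star_adj eqxx. Qed.

Lemma star_gt0 : 0 < #|{: option 'I_l}|.
Proof. by rewrite card_option. Qed.

Definition star : sgraph := SGraph star_adj star_adj_sym star_adj_irrefl star_gt0.

End Star.

Section Betweenness.
Variable G : sgraph.

(* A tuple p stands for the path v :: p of length n, so that p omits v but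
   ends with w. *)
Definition paths (v w : G) (n : nat) : {set n.-tuple G} :=
  [set p : n.-tuple G | [&& path adj v p, last v p == w & uniq (v :: p)]].

(* Paths have length less than #|G|; the value is #|G| when v and w are not
   connected. *)
Definition dist (v w : G) : nat :=
  find (fun n => paths v w n != set0) (iota 0 #|G|).

Definition geodesics (v w : G) : {set (dist v w).-tuple G} :=
  paths v w (dist v w).

Definition sigma (v w : G) : nat := #|geodesics v w|.

Definition sigma_through (v w x : G) : nat :=
  #|[set p in geodesics v w | [&& x \in v :: p, x != v & x != w]]|.

(* The comparison of enum_rank selects one ordering (v, w) of each unordered
   pair of distinct vertices. *)
Definition betweenness (x : G) : rat :=
  (\sum_(v : G) \sum_(w : G | (enum_rank v < enum_rank w)%N)
     (sigma_through v w x)%:R / (sigma v w)%:R)%R.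

Definition BUG : Prop :=
  connected G /\ forall x y : G, betweenness x = betweenness y.

Definition low_betweenness_BUG : Prop :=
  BUG /\ forall x : G, (betweenness x < 1)%R.

End Betweenness.

Definition equal_stars (G : sgraph) : Prop :=
  exists l : nat, forall x : G, isomorphic (component x) (star l).

Definition exotic_BUG (G : sgraph) : Prop :=
  low_betweenness_BUG G /\ ~ equal_stars (compl G).

Definition exotic_coBUG (H : sgraph) : Prop :=
  exists2 G : sgraph, exotic_BUG G & isomorphic H (compl G).

(* Main.v *)
Require Import Defs.
From mathcomp Require Import all_boot all_order all_algebra.
From mathcomp Require Import zify ring lra.

(* Let G be the exotic BUG, n its order and e the adjacency of its complement.
   Each edge vw of the complement has d = |N(v) u N(w)| < n, and v, w have the
   n - d vertices outside N(v) u N(w) as their common neighbours in G.  Put the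
   weight 1/(n - d) on vw, and let the load of x be the total weight of the
   edges with x in N(v) u N(w).  The betweenness of x is the total weight minus
   its load, so the load is constant; and betweenness < 1 means that the
   complement has fewer than n edges.

   Comparing the loads of a leaf and of its siblings shows that the component
   of a leaf is a star, and the value of the load on K_{1,7} forces all these
   stars to be K_{1,7}.  Let P be the set of the other vertices, p = |P|, q the
   number of edges inside P, and m = n - 8 = 8t + p, where t + 1 is the number
   of stars.  In P all degrees are at least 2, every load is 7/m, and
   p <= q <= p + t.  A vertex u of P has at least |N(u) u N(v)| edges in its
   load, for each neighbour v.  This excludes d >= 9 in P (such an edge needs
   t >= 3, hence m >= 33, whereas nine edges in the load of u give m <= 28),
   and with d <= 8 in P it gives at least 8 edges in every load: the weights are
   then at most 1/m, so 7 edges suffice for 7/m only if d = 8 for all of them.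
   Jensen's inequality for d/(n - d), summed over the edges in P, then yields
   m q <= 56 (q - p) <= 56 t, contradicting q >= 8 and m > 7 t. *)

Set Implicit Arguments.
Unset Strict Implicit.
Unset Printing Implicit Defensive.

Import Order.TTheory GRing.Theory Num.Theory.

(* Jensen for d |-> d / (n - d), by its tangent at the mean of d. *)
Lemma ratio_sum_ge (R : realFieldType) (I : finType) (A : {set I})
    (d : I -> R) (n s : R) :
    (forall i, i \in A -> (d i < n)%R) -> (0 <= n)%R ->
    (s <= \sum_(i in A) d i)%R ->
  (#|A|%:R * s <= (#|A|%:R * n - s) * \sum_(i in A) d i / (n - d i))%R.
Proof.
move=> dn n0 sd; have [->|[i0 i0A]] := set_0Vmem A.
  by rewrite cards0 big_set0 !mul0r mulr0.
have pos : (0 < #|A|%:R * n - s)%R.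
  rewrite subr_gt0 (le_lt_trans sd) // mulr_natl -sumr_const.
  by apply: ltr_sum => //; apply/hasP; exists i0; rewrite ?mem_index_enum.
(* For x = n - d, the tangent of 1/x at 1/l is 2l - l^2 x, where 1/l is the mean of x if the [d i]
   sum to exactly [s]. Its gap, scaled by n, is n (1 - l x)^2 / x. *)
pose l : R := (#|A|%:R / (#|A|%:R * n - s))%R.
have tangent i : i \in A ->
    (n * (2%:R * l - l ^+ 2 * (n - d i)) - 1 <= d i / (n - d i))%R.
  move=> /dn; rewrite -subr_gt0; move: (d i) => c c0.
  have : (0 <= n * ((1 - l * (n - c)) ^+ 2 / (n - c)))%R.
    by rewrite mulr_ge0 // divr_ge0 ?sqr_ge0 // ltW.
  have -> : (n * ((1 - l * (n - c)) ^+ 2 / (n - c)) =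
             c / (n - c) - (n * (2%:R * l - l ^+ 2 * (n - c)) - 1))%R.
    by field; lra.
  by rewrite subr_ge0.
have sumE : (\sum_(i in A) (n * (2%:R * l - l ^+ 2 * (n - d i)) - 1) =
    n * (2%:R * l * #|A|%:R - l ^+ 2 * (#|A|%:R * n - \sum_(i in A) d i))
    - #|A|%:R)%R.
  rewrite (eq_bigr (fun i =>
    n * l ^+ 2 * d i + (n * (2%:R * l - l ^+ 2 * n) - 1))%R).
    rewrite big_split /= -mulr_sumr sumr_const -[X in (_ + X)%R]mulr_natl.
    by ring.
  by move=> i _; ring.
have -> : (#|A|%:R * s = (#|A|%:R * n - s) * (n * (2%:R * l * #|A|%:R
    - l ^+ 2 * (#|A|%:R * n - s)) - #|A|%:R))%R.
  by rewrite /l; field; lra.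
rewrite ler_pM2l //; apply: le_trans (ler_sum _ tangent); rewrite sumE.
(* The tangents have slope n l^2 >= 0 in [d i], so [s] may replace the larger sum of [d]. *)
rewrite lerD2r ler_wpM2l // lerD2l lerN2 ler_wpM2l ?sqr_ge0 //.
by rewrite lerD2l lerN2.
Qed.

(** Clears [m] and cancels [p] in the Jensen bound for [q] darts, with n = m + 8 and s = 16 p. *)
Lemma mean_bound (R : realFieldType) (m p q : R) :
  (0 < m -> 0 < p ->
   q * (16%:R * p) <= (q * (m + 8%:R) - 16%:R * p) * (p * (14%:R / m)) ->
   m * q <= 56%:R * q - 112%:R * p)%R.
Proof.
move=> m0 p0; rewrite -(ler_pM2r m0).
have -> : ((q * (m + 8%:R) - 16%:R * p) * (p * (14%:R / m)) * m =
           (q * (m + 8%:R) - 16%:R * p) * 14%:R * p)%R by field; lra.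
have -> : (q * (16%:R * p) * m = q * 16%:R * m * p)%R by ring.
by rewrite ler_pM2r //; lra.
Qed.

(** * Loads of vertices and leaves of the complement *)

Section Loads.
Variables (V : finType) (e : rel V).
Hypotheses (adjC : symmetric e) (adjxx : irreflexive e).

Definition nbhd (v : V) : {set V} := [set y | e v y].
Definition nbhd2 (v w : V) : {set V} := nbhd v :|: nbhd w.
(* A dart is an edge with a direction: counts and loads over darts are twice
   those over edges. *)
Definition darts_at (x : V) : {set V * V} :=
  [set q | e q.1 q.2 & x \in nbhd2 q.1 q.2].
Definition wt (q : V * V) : rat := (#|~: nbhd2 q.1 q.2|%:R^-1)%R.
Definition load (x : V) : rat := (\sum_(q in darts_at x) wt q)%R.

Hypothesis card_nbhd2C_gt0 : forall v w, e v w -> 0 < #|~: nbhd2 v w|.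
Hypothesis load_const : forall x y, load x = load y.

Lemma in_darts_at x v w :
  ((v, w) \in darts_at x) = e v w && (e v x || e w x).
Proof. by rewrite !inE. Qed.

Lemma wt_gt0 q : e q.1 q.2 -> (0 < wt q)%R.
Proof. by move=> eq; rewrite invr_gt0 ltr0n card_nbhd2C_gt0. Qed.

Lemma wt_ge0 q : (0 <= wt q)%R.
Proof. by rewrite invr_ge0 ler0n. Qed.

(** A dart counted at the leaf [x] has [u] as an end, so it is counted at [y] too. A second
    neighbour [z] of [y] would add the dart (y, z), not counted at [x], and make the load of [y]
    larger. *)
Lemma leaf_sibling x u y : nbhd x = [set u] -> e u y -> nbhd y = [set u].
Proof.
move=> xu uy; have ex z : e x z = (z == u).
  by have /setP/(_ z) := xu; rewrite !inE.
apply/eqP; rewrite eqEsubset sub1set !inE adjC uy andbT.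
apply/subsetP=> z; rewrite !inE => yz; apply/negPn/negP => zu.
have yu : y != u by apply: contraTneq uy => ->; rewrite adjxx.
suff : (load x < load y)%R by rewrite (load_const x y) ltxx.
have sub : darts_at x \subset darts_at y.
  apply/subsetP=> -[v w]; rewrite !in_darts_at => /andP[-> /=].
  by rewrite ![e _ x]adjC !ex => /orP[] /eqP->; rewrite uy ?orbT.
rewrite /load (big_setID (darts_at x) wt (A := darts_at y)) /=.
move/setIidPr: (sub) => ->; rewrite ltrDl.
rewrite (bigD1 (y, z)) /=.
  apply: ltr_wpDr; last exact: wt_gt0.
  by apply: sumr_ge0 => q _; apply: wt_ge0.
rewrite inE !in_darts_at yz [e z y]adjC yz orbT andbT /=.
by rewrite ![e _ x]adjC !ex negb_or yu zu.
Qed.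

(** Only the edges at [u] are counted at [x], in both directions. As the siblings of [x] are leaves,
    [nbhd2] of each such edge consists of [u] and its neighbours. *)
Lemma load_leaf x u : nbhd x = [set u] ->
  (load x = (2 * #|nbhd u|)%:R / (#|V| - #|nbhd u|.+1)%:R)%R.
Proof.
move=> xu; have ex z : e x z = (z == u).
  by have /setP/(_ z) := xu; rewrite !inE.
have unu : u \notin nbhd u by rewrite inE adjxx.
have cardC y : e u y ->
    (#|~: nbhd2 u y| = #|V| - #|nbhd u|.+1) /\
    (#|~: nbhd2 y u| = #|V| - #|nbhd u|.+1).
  move=> uy; rewrite /nbhd2 (leaf_sibling xu uy) [_ :|: nbhd u]setUC.
  by rewrite cardsCs setCK setUC cardsU1 unu.
have dE : darts_at x =
    [set (u, y) | y in nbhd u] :|: [set (y, u) | y in nbhd u].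
  apply/setP=> -[v w]; rewrite in_darts_at ![e _ x]adjC !ex inE.
  apply/idP/idP.
    case/andP=> vw /orP[] /eqP E; subst; apply/orP; [left|right];
      by apply/imsetP; eexists; last reflexivity; rewrite inE // adjC.
  by case/orP => /imsetP[y]; rewrite inE => uy [-> ->];
    rewrite eqxx ?orbT ?andbT // adjC.
have dis : [disjoint [set (u, y) | y in nbhd u] & [set (y, u) | y in nbhd u]].
  rewrite disjoint_subset; apply/subsetP=> _ /imsetP[y yu ->]; rewrite !inE.
  apply/negP=> /imsetP[z zu [uz _]]; subst z.
  by rewrite (negbTE unu) in zu.
rewrite /load (eq_bigr (fun=> ((#|V| - #|nbhd u|.+1)%:R^-1)%R)); last first.
  move=> [v w]; rewrite dE inE => /orP[] /imsetP[y]; rewrite inE => uy [-> ->];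
    by have [E1 E2] := cardC y uy; rewrite /wt ?E1 ?E2.
rewrite sumr_const dE cardsU disjoint_setI0 // cards0 subn0.
rewrite !card_imset; first last.
- by move=> ? ? [].
- by move=> ? ? [].
by rewrite addnn -mul2n -[LHS]mulr_natl.
Qed.


Lemma nbhd2C v w : nbhd2 v w = nbhd2 w v.
Proof. exact: setUC. Qed.

Definition swap (q : V * V) := (q.2, q.1).

Lemma swapK : involutive swap.
Proof. by case. Qed.

Lemma in_swap_imset (S : {set V * V}) q : (q \in swap @: S) = (swap q \in S).
Proof. by rewrite -{1}[q]swapK mem_imset //; apply: can_inj swapK. Qed.

(** [enum_rank] selects one dart from each pair of opposite darts. This parity sharpens strict
    bounds on dart counts. *)
Lemma even_card_swap (S : {set V * V}) :
  (forall q, (swap q \in S) = (q \in S)) -> (forall v, (v, v) \notin S) ->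
  ~~ odd #|S|.
Proof.
move=> Ssw Sdiag.
pose h : {set V * V} := [set q | enum_rank q.1 < enum_rank q.2].
have -> : S = (S :&: h) :|: swap @: (S :&: h).
  apply/setP=> -[v w]; rewrite !inE /=.
  rewrite in_swap_imset !inE Ssw /= -andb_orr; case vwS: (_ \in S) => //=.
  rewrite -neq_ltn; apply/esym; apply: contraTneq vwS
    => /val_inj/enum_rank_inj->.
  exact: Sdiag.
rewrite cardsU.
have -> : (S :&: h) :&: swap @: (S :&: h) = set0.
  apply/setP=> -[v w]; rewrite inE in_swap_imset !inE /=.
  by case: ltngtP; rewrite !andbF.
by rewrite card_imset ?cards0 ?subn0 ?addnn ?odd_double //;
  apply: can_inj swapK.
Qed.

(* Each t in N(u) u N(v) is charged to an edge counted at u: to ut or vt if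
   t <> u, and u itself to an edge yz with y <> v a neighbour of u, z <> u. *)
Lemma card_darts_at_ge u v : e u v ->
  1 < #|nbhd u| -> (forall y, e u y -> 1 < #|nbhd y|) ->
  2 * #|nbhd2 u v| <= #|darts_at u|.
Proof.
move=> uv du dn.
have other (a b : V) : 1 < #|nbhd a| -> exists2 c, e a c & c != b.
  move=> da; have : 0 < #|nbhd a :\ b|.
    by move: da; rewrite (cardsD1 b); case: (b \in _) => //; case: #|_|.
  by case/card_gt0P=> c; rewrite !inE => /andP[cb ac]; exists c.
have [y uy yv] := other _ v du; have [z yz zu] := other _ u (dn _ uy).
have vu : v != u by apply: contraTneq uv => ->; rewrite adjxx.
have yu : y != u by apply: contraTneq uy => ->; rewrite adjxx.
have zy : z != y by apply: contraTneq yz => ->; rewrite adjxx.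
pose g t := if t == u then (y, z) else if e u t then (u, t) else (v, t).
have sub (b : bool) t : t \in nbhd2 u v ->
    (if b then g t else swap (g t)) \in darts_at u.
  move=> tN; suff gt : g t \in darts_at u.
    case: b => //; case: (g t) gt => p q; rewrite !in_darts_at.
    by rewrite adjC orbC.
  rewrite /g; case: eqP => [_|_]; first by rewrite in_darts_at yz (adjC y) uy.
  case: ifP => ut; rewrite in_darts_at.
    by rewrite ut (adjC t) ut orbT.
  by move: tN; rewrite !inE ut /= => ->; rewrite adjC uv.
(* The boolean chooses the direction, so each charged edge supplies both of its darts. *)
pose f (bt : bool * V) := if bt.1 then g bt.2 else swap (g bt.2).
have finj : {in setX [set: bool] (nbhd2 u v) &, injective f}.
  move=> [b s] [c t]; rewrite !inE /= => sN tN; rewrite /f /g /=.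
  move/eqP: vu => vu; move/eqP: yv => yv; move/eqP: yu => yu.
  move/eqP: zu => zu; move/eqP: zy => zy.
  have [uv1 uy1] : e u v = true /\ e u y = true by [].
  by case: b; case: c; case: (s =P u) => su; case: (t =P u) => tu;
    case us: (e u s); case ut: (e u t); move=> E;
    have := congr1 fst E; have := congr1 snd E; move=> /= *; congruence.
have <- : #|f @: setX [set: bool] (nbhd2 u v)| = 2 * #|nbhd2 u v|.
  by rewrite card_in_imset // cardsX cardsT card_bool.
apply/subset_leq_card/subsetP=> _ /imsetP[[b t] + ->].
by rewrite in_setX in_setT /=; apply: sub.
Qed.

(** * Emptiness of the part outside the stars *)

Section Core.
Variables (P : {set V}) (t : nat).
Hypotheses (P_closed : forall x y, x \in P -> e x y -> y \in P)
  (P_deg : forall x, x \in P -> 1 < #|nbhd x|)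
  (P_load : forall x, x \in P -> (load x = 14%:R / (#|V| - 8)%:R)%R)
  (cardV : #|V| = 8 * t + 8 + #|P|)
  (P_darts : \sum_(x in P) #|nbhd x| <= 2 * #|P| + 2 * t).

Let D : {set V * V} := [set q | (q.1 \in P) && e q.1 q.2].

Lemma card_core_darts : #|D| = \sum_(x in P) #|nbhd x|.
Proof.
rewrite -sum1_card (eq_bigl (fun q => (q.1 \in P) && e q.1 q.2)); last first.
  by move=> q; rewrite inE.
rewrite -(pair_big_dep (mem P) e (fun _ _ => 1)) /=.
by apply: eq_bigr => x _; rewrite sum1_card; apply: eq_card => y; rewrite inE.
Qed.

Lemma sub_nbhd2_core v w : v \in P -> e v w -> nbhd2 v w \subset P.
Proof.
move=> vP vw; apply/subsetP=> x; rewrite !inE => /orP[]; apply: P_closed => //.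
exact: P_closed vw.
Qed.

Lemma darts_at_core x : x \in P -> darts_at x \subset D.
Proof.
move=> xP; apply/subsetP=> -[v w]; rewrite in_darts_at !inE /= => /andP[vw].
rewrite vw andbT => /orP[] h; first by apply: P_closed xP _; rewrite adjC.
have wP : w \in P by apply: P_closed xP _; rewrite adjC.
by apply: P_closed wP _; rewrite adjC.
Qed.

(** Double counting: a dart of [D] is counted at exactly the vertices of its [nbhd2], all of which
    lie in [P]. *)
Lemma sum_darts_at_core (F : V * V -> rat) :
  (\sum_(x in P) \sum_(q in darts_at x) F q =
   \sum_(q in D) #|nbhd2 q.1 q.2|%:R * F q)%R.
Proof.
rewrite (exchange_big_dep (mem D)) /=; last first.
  by move=> x q xP; apply/subsetP/darts_at_core.
apply: eq_bigr => -[v w]; rewrite inE /= => /andP[vP vw].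
rewrite -sumr_const mulr_suml (eq_bigl (mem (nbhd2 v w))) => [|x].
  by apply: eq_bigr => x _; rewrite mul1r.
rewrite /= inE /= vw /=; apply: andb_idl; exact/subsetP/sub_nbhd2_core.
Qed.

Lemma card_nbhd2D v w : #|V| = #|nbhd2 v w| + #|~: nbhd2 v w|.
Proof. by rewrite cardsC. Qed.

Lemma core_degs u v : u \in P -> e u v ->
  #|nbhd u| + #|nbhd v| + 2 * (#|P| - 2) <= \sum_(x in P) #|nbhd x|.
Proof.
move=> uP uv; have vP := P_closed uP uv.
have vu : v != u by apply: contraTneq uv => ->; rewrite adjxx.
rewrite (bigD1 u) //= (bigD1 v) ?vP //= -addnA !leq_add2l.
have -> : #|P| - 2 = #|P :\ u :\ v|.
  by rewrite (cardsD1 u P) (cardsD1 v (P :\ u)) !inE uP vP vu /=; lia.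
rewrite mulnC -sum_nat_const.
rewrite [leqRHS](eq_bigl (mem (P :\ u :\ v))) => [|x]; last first.
  by rewrite !inE; do !case: (_ == _); rewrite ?andbF ?andbT.
by apply: leq_sum => x; rewrite !inE => /and3P[_ _ /P_deg].
Qed.

Lemma core_nbhd2_le u v : u \in P -> e u v -> #|nbhd2 u v| <= 8.
Proof.
move=> uP uv; rewrite leqNgt; apply/negP => d9.
have cP : #|nbhd2 u v| <= #|P| by apply/subset_leq_card/sub_nbhd2_core.
have cU : #|nbhd2 u v| <= #|nbhd u| + #|nbhd v| by rewrite cardsU leq_subr.
(* The degree sum gives 9 + 2 (|P| - 2) <= 2 |P| + 2 t. *)
have t3 : 3 <= t by have := leq_trans (core_degs uP uv) P_darts; lia.
have S18 : 18 <= #|darts_at u|.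
  by have := card_darts_at_ge uv (P_deg uP)
    (fun y uy => P_deg (P_closed uP uy)); lia.
(* Every weight is at least 1/n. Then 18/n <= 14/(n - 8) means n <= 36, but t >= 3 and |P| >= 9 give
   n >= 41. *)
have : (18%:R / #|V|%:R <= load u)%R.
  apply: (@le_trans _ _ (\sum_(q in darts_at u) #|V|%:R^-1)%R).
    rewrite sumr_const -[X in (_ <= X)%R]mulr_natl ler_wpM2r ?ler_nat //.
    by rewrite invr_ge0 ler0n.
  apply: ler_sum => -[v' w']; rewrite inE /= => /andP[vw _].
  rewrite lef_pV2 ?posrE ?ltr0n ?card_nbhd2C_gt0 ?ler_nat ?max_card //.
  by rewrite cardV; lia.
have V0 : (0 < #|V|%:R :> rat)%R by rewrite ltr0n cardV; lia.
have m0 : (0 < (#|V| - 8)%:R :> rat)%R by rewrite ltr0n cardV; lia.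
rewrite (P_load uP) ler_pdivrMr // mulrAC ler_pdivlMr //.
by rewrite -!natrM ler_nat cardV; lia.
Qed.

Lemma core_darts_at_ge x : x \in P -> 16 <= #|darts_at x|.
Proof.
move=> xP; have Px y : e x y -> y \in P by apply: P_closed.
have ev : ~~ odd #|darts_at x|.
  apply: even_card_swap => [[v w]|v]; rewrite !in_darts_at ?adjxx //.
  by rewrite adjC orbC.
have m0 : 0 < #|V| - 8.
  by have : 0 < #|P| by [apply/card_gt0P; exists x]; rewrite cardV; lia.
have wle q : q \in darts_at x -> (wt q <= (#|V| - 8)%:R^-1)%R.
  move=> qx; have := subsetP (darts_at_core xP) _ qx.
  rewrite inE => /andP[q1P q12].
  rewrite lef_pV2 ?posrE ?ltr0n ?card_nbhd2C_gt0 ?ler_nat //.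
  by have := core_nbhd2_le q1P q12; have := card_nbhd2D q.1 q.2; lia.
have [y xy] : exists y, e x y.
  have : 0 < #|nbhd x| by have := P_deg xP; lia.
  by case/card_gt0P=> y; rewrite inE; exists y.
have := card_darts_at_ge xy (P_deg xP) (fun y xy => P_deg (Px y xy)).
(* If d = 8 for this edge, the charging bound is already 16; if d <= 7, its weight is strictly below
   1/(n - 8). *)
have := core_nbhd2_le xP xy; rewrite leq_eqVlt => /orP[/eqP-> //|d7 _].
suff : 14 < #|darts_at x|.
  by have : #|darts_at x| != 15 by [apply: contraNneq ev => ->]; lia.
have xyx : (x, y) \in darts_at x by rewrite in_darts_at xy adjC xy orbT.
have wxy : (wt (x, y) < (#|V| - 8)%:R^-1)%R.
  rewrite ltf_pV2 ?posrE ?ltr0n ?card_nbhd2C_gt0 // ltr_nat.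
  by rewrite -[X in _ < X]/(#|~: nbhd2 x y|); have := card_nbhd2D x y; lia.
suff : (load x < #|darts_at x|%:R / (#|V| - 8)%:R)%R.
  by rewrite P_load // ltr_pM2r ?invr_gt0 ?ltr0n // ltr_nat.
rewrite mulr_natl -sumr_const /load (bigD1 (x, y)) // [ltRHS](bigD1 (x, y)) //.
by apply: ltr_leD => //; apply: ler_sum => q /andP[qx _]; apply: wle.
Qed.

Lemma core_empty : P = set0.
Proof.
apply/eqP/negPn/negP => /set0Pn[x xP].
have p0 : 0 < #|P| by apply/card_gt0P; exists x.
have Qe : #|D| <= 2 * #|P| + 2 * t by rewrite card_core_darts.
have Q16 : 16 <= #|D|.
  apply: leq_trans (core_darts_at_ge xP) _.
  exact/subset_leq_card/darts_at_core.
set m := #|V| - 8; have nE : #|V| = m + 8 by rewrite /m cardV; lia.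
(* The right side is at most 112 t by [Qe], whereas the left side is at least 16 m = 128 t + 16
   |P|. *)
suff : (m%:R * #|D|%:R <= 56%:R * #|D|%:R - 112%:R * #|P|%:R :> rat)%R.
  have : (#|D|%:R <= 2%:R * #|P|%:R + 2%:R * t%:R :> rat)%R.
    by rewrite -!natrM -natrD ler_nat.
  have : (m%:R * 16%:R <= m%:R * #|D|%:R :> rat)%R.
    by rewrite ler_wpM2l // (ler_nat _ 16).
  have : (1 <= #|P|%:R :> rat)%R by rewrite ler1n.
  have -> : (m%:R = 8%:R * t%:R + #|P|%:R :> rat)%R.
    by rewrite -natrM -natrD /m cardV; congr (_%:R)%R; lia.
  have : (0 <= t%:R :> rat)%R by rewrite ler0n.
  by lra.
have m0 : (0 < m%:R :> rat)%R by rewrite ltr0n /m cardV; lia.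
have sum1 : (\sum_(q in D) #|nbhd2 q.1 q.2|%:R * wt q =
             #|P|%:R * (14%:R / m%:R))%R.
  rewrite -sum_darts_at_core (eq_bigr (fun=> (14%:R / m%:R)%R)) => [|y yP].
    by rewrite sumr_const [RHS]mulr_natl.
  exact: P_load.
(* The same double counting with unit weights, using at least 16 darts at each vertex of [P]. *)
have sum2 : (16%:R * #|P|%:R <= \sum_(q in D) #|nbhd2 q.1 q.2|%:R :> rat)%R.
  have := sum_darts_at_core (fun=> 1%R).
  rewrite [X in _ = X -> _](eq_bigr _ (fun _ _ => mulr1 _)) => <-.
  rewrite mulrC mulr_natl -sumr_const; apply: ler_sum => y yP.
  by rewrite sumr_const ler_nat core_darts_at_ge.
pose d q : rat := (#|nbhd2 q.1 q.2|%:R)%R.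
have wtE q : q \in D ->
    (d q < #|V|%:R)%R /\ (d q * wt q = d q / (#|V|%:R - d q))%R.
  rewrite inE => /andP[_ /card_nbhd2C_gt0 c0].
  rewrite /wt /d (card_nbhd2D q.1 q.2) ltr_nat; split; first lia.
  by rewrite natrD addrC addKr.
have := @ratio_sum_ge _ _ D d #|V|%:R _ (fun q qD => (wtE q qD).1) _ sum2.
rewrite -(eq_bigr _ (fun q qD => (wtE q qD).2)) sum1 ler0n => /(_ isT).
rewrite nE natrD; apply: mean_bound => //; by rewrite ltr0n.
Qed.

End Core.

(** * Partition of the vertices into leaves, star centres and the rest *)

Lemma star_cover x0 u0 : nbhd x0 = [set u0] -> #|nbhd u0| = 7 ->
  \sum_(x : V) #|nbhd x| < 2 * #|V| ->
  forall x, exists c, [/\ #|nbhd c| = 7, forall y, e c y -> nbhd y = [set c]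
                        & x = c \/ e c x].
Proof.
move=> x0u0 u07 dartsV.
have nbhd1 a b : nbhd a = [set b] -> e a b.
  by move/setP/(_ b); rewrite !inE eqxx.
have cardV k a b : nbhd a = [set b] -> #|nbhd b| = k -> k.+1 < #|V|.
  move=> ab bk; have ba : e b a by rewrite adjC nbhd1.
  have := card_nbhd2C_gt0 ba; have := card_nbhd2D b a.
  by rewrite /nbhd2 ab setUC cardsU1 inE adjxx bk; lia.
have V8 := cardV 7 _ _ x0u0 u07.
have loadE x : (load x = 14%:R / (#|V| - 8)%:R)%R.
  by rewrite (load_const x x0) (load_leaf x0u0) u07.
have leaf7 a b : nbhd a = [set b] -> #|nbhd b| = 7.
  move=> ab; have := cardV _ a b ab erefl; have := loadE a.
  rewrite (load_leaf ab); move: #|nbhd b| => k kE k_lt.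
  apply/eqP; move/eqP: kE.
  (* Cross-multiplied, 2k/(n - k - 1) = 14/(n - 8) amounts to (k - 7)(n - 1) = 0. *)
  rewrite eqr_div ?pnatr_eq0; try lia.
  by rewrite -!natrM eqr_nat; nia.
(* An isolated vertex would have load 0, but the common load is positive. *)
have nbhd_gt0 x : 0 < #|nbhd x|.
  rewrite lt0n; apply: contra_eq_neq (loadE x) => /cards0_eq x0'.
  have -> : load x = 0%R.
    rewrite /load big1 // => -[v w]; rewrite in_darts_at ![e _ x]adjC.
    have /setP x0E := x0'; have := x0E v; have := x0E w; rewrite !inE.
    by move=> -> ->; rewrite andbF.
  by rewrite eq_sym mulf_neq0 ?invr_eq0 ?pnatr_eq0 //; lia.
pose L := [set x | #|nbhd x| == 1]; pose U := [set x | [exists y in L, e x y]].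
pose P := ~: (L :|: U).
have L1 x : x \in L -> exists2 c, c \in U & nbhd x = [set c].
  rewrite inE => /[dup] xL /cards1P[c xc]; exists c => //; rewrite inE.
  by apply/existsP; exists x; rewrite inE xL adjC nbhd1.
have UE c : c \in U -> #|nbhd c| = 7 /\ forall y, e c y -> nbhd y = [set c].
  rewrite inE => /existsP[x /andP[/L1[c' _ xc'] cx]].
  have cc' : c' = c.
    apply/eqP; rewrite eq_sym; have /setP/(_ c) := xc'.
    by rewrite !inE adjC cx => <-.
  rewrite cc' in xc'; split; first exact: leaf7 xc'.
  by move=> y cy; apply: leaf_sibling xc' cy.
have UL c : c \in U -> c \notin L by move=> /UE[c7 _]; rewrite inE c7.
(* Counts the pairs of a leaf and its unique centre in two ways. *)
have cardL : #|L| = 7 * #|U|.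
  rewrite mulnC -sum_nat_const -sum1_card.
  transitivity (\sum_(l in L) \sum_(c in U | e l c) 1).
    apply: eq_bigr => l /L1[c cU lc]; rewrite (big_pred1 c) // => c'.
    have -> : e l c' = (c' == c) by have /setP/(_ c') := lc; rewrite !inE.
    by rewrite andb_idl // => /eqP->.
  rewrite (exchange_big_dep (mem U)) /=; last by move=> ? ? _ /andP[].
  apply: eq_bigr => c cU; have [c7 cl] := UE c cU; rewrite -c7 -sum1_card.
  apply: eq_bigl => l; rewrite cU /= [RHS]inE adjC andb_idl // => /cl lc.
  by rewrite inE lc cards1.
have LU0 : L :&: U = set0.
  apply/setP=> x; rewrite in_setI in_set0; apply/negP=> /andP[xL /UL].
  by rewrite xL.
have cardVE : #|V| = 8 * #|U| + #|P|.
  by rewrite -(cardsC (L :|: U)) cardsU cardL LU0 cards0 -/P; lia.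
have U0 : 0 < #|U|.
  have [|c cU _] := L1 x0; first by rewrite inE x0u0 cards1.
  by apply/card_gt0P; exists c.
have P_closed x y : x \in P -> e x y -> y \in P.
  rewrite !in_setC !in_setU !negb_or => /andP[xL xU] xy; apply/andP; split.
    by apply: contra xU => yL; rewrite inE; apply/existsP; exists y; rewrite yL.
  apply: contra xL => /UE[_ /(_ x)]; rewrite adjC xy inE => -> //.
  by rewrite cards1.
have P_deg x : x \in P -> 1 < #|nbhd x|.
  rewrite in_setC in_setU negb_or inE => /andP[x1 _].
  by have := nbhd_gt0 x; move: x1; case: #|_| => [|[]].
have degE : \sum_(x : V) #|nbhd x| = 14 * #|U| + \sum_(x in P) #|nbhd x|.
  rewrite (bigID (mem (L :|: U))) /=; congr (_ + _); last first.
    by apply: eq_bigl => x; rewrite in_setC.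
  rewrite (big_setID L) /= setUK setDUl setDv set0U.
  have /setDidPl -> : [disjoint U & L] by rewrite -setI_eq0 setIC LU0.
  rewrite (eq_bigr (fun=> 1)) => [|x]; last by rewrite inE => /eqP.
  rewrite [X in _ + X](eq_bigr (fun=> 7)) => [|x /UE[]] //.
  by rewrite !sum_nat_const cardL; lia.
have notP x : x \notin P -> x \in L :|: U by rewrite in_setC negbK.
clearbody P.
(* Parity improves the bound sum < 2 |P| + 2 |U| by 2, which allows t = |U| - 1 in [core_empty]. *)
have Pev : ~~ odd (\sum_(x in P) #|nbhd x|).
  rewrite -card_core_darts; apply: even_card_swap => [[v w]|v]; rewrite !inE /=.
    by apply/andP/andP => -[h1 h2]; rewrite (P_closed _ _ h1 h2) adjC h2.
  by rewrite adjxx andbF.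
have P0 : P = set0.
  apply: (core_empty (t := #|U|.-1) P_closed P_deg) => //; first by lia.
  have : \sum_(x in P) #|nbhd x| < 2 * #|P| + 2 * #|U| by lia.
  by move: Pev; lia.
move=> x; have /notP : x \notin P by rewrite P0 in_set0.
rewrite in_setU => /orP[/L1[c cU xc]|xU].
  by have [c7 cN] := UE c cU; exists c; split=> //; right; rewrite adjC nbhd1.
by have [x7 xN] := UE x xU; exists x; split=> //; left.
Qed.

End Loads.

(** * Betweenness in terms of loads in the complement *)

Section Betweenness.
Variable G : sgraph.
Implicit Types v w x y : G.

Let e : rel G := @compl_adj G.

Lemma compl_adjN v w : v != w -> e v w = ~~ adj v w.
Proof. by move=> vw; rewrite /e /compl_adj vw. Qed.

Lemma adj_neq v w : adj v w -> v != w.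
Proof. by apply: contraTneq => ->; rewrite adj_irrefl. Qed.

Lemma paths0 v w : v != w -> paths v w 0 = set0.
Proof.
by move=> vw; apply/setP=> p; rewrite !inE tuple0 /= (negbTE vw).
Qed.

Lemma paths1_eq0 v w : (paths v w 1 == set0) = ~~ adj v w.
Proof.
apply/idP/idP => [|vw].
  apply: contraTN => vw; apply/set0Pn; exists [tuple w].
  by rewrite !inE /= vw eqxx inE adj_neq.
apply/set0Pn => -[p]; case/tupleP: p => a p; rewrite tuple0 !inE /=.
by case/and3P=> /andP[va _] /eqP aw _; rewrite -aw va in vw.
Qed.

Lemma paths2 v w : v != w ->
  paths v w 2 = [set [tuple y; w] | y in [set y | adj v y && adj y w]].
Proof.
move=> vw; apply/setP=> p; apply/idP/imsetP => [|[y + ->]].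
  case/tupleP: p => a p; case/tupleP: p => b p; rewrite tuple0 !inE /=.
  case/and3P=> /and3P[va ab _] /eqP bw _; exists a; first by rewrite inE va -bw.
  by apply: val_inj; rewrite /= bw.
rewrite !inE /= => /andP[vy yw].
by rewrite vy yw eqxx !inE negb_or vw !adj_neq.
Qed.

Lemma dist1 v w : adj v w -> dist v w = 1.
Proof.
move=> vw; have := adj_neq vw => v_w.
have : 1 < #|G| by have := max_card (mem [set v; w]); rewrite cards2 v_w.
rewrite /dist; case: #|G| => [|[|n _]] //=.
by rewrite paths0 // eqxx paths1_eq0 vw.
Qed.

Lemma dist2 v w y : v != w -> ~~ adj v w -> adj v y -> adj y w ->
  dist v w = 2.
Proof.
move=> v_w vw vy yw.
(* [dist] searches only lengths below [#|G|], so length 2 is reached because [y], [v], [w] are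
   distinct. *)
have : 2 < #|G|.
  apply: leq_trans (max_card (mem [set y; v; w])).
  by rewrite -setUA cardsU1 cards2 v_w !inE negb_or eq_sym !adj_neq.
rewrite /dist; case: #|G| => [|[|[|n _]]] //=.
rewrite paths0 // eqxx paths1_eq0 vw /=; case: ifP => // /negbFE/eqP E.
have /setP/(_ [tuple y; w]) := E.
rewrite paths2 // in_set0 mem_imset ?inE ?vy ?yw //.
by move=> a b [].
Qed.

Lemma sigma_through_adj v w x : adj v w -> sigma_through v w x = 0.
Proof.
move=> vw; rewrite /sigma_through /geodesics dist1 //; apply/eqP.
rewrite cards_eq0; apply/set0Pn => -[p].
case/tupleP: p => a p; rewrite tuple0 !inE /=.
by case/andP=> /and3P[_ /eqP-> _]; case/and3P=> /orP[] /eqP->; rewrite eqxx.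
Qed.

(** The ends [v] and [w] fail both sides; for any other [y], non-adjacency in the complement is
    adjacency in [G]. *)
Lemma mem_nbhd2C v w y : e v w ->
  (y \in ~: nbhd2 e v w) = adj v y && adj y w.
Proof.
move=> /andP[v_w vw]; rewrite !inE negb_or /e /compl_adj !negb_and !negbK.
have [<-|_] := eqVneq v y.
  by rewrite adj_irrefl /= (adj_sym w) (negbTE vw) eq_sym (negbTE v_w).
have [<-|_] := eqVneq w y; first by rewrite adj_irrefl (negbTE vw).
by rewrite (adj_sym w).
Qed.

(** A common neighbour makes the distance 2, and a geodesic of length 2 is determined by its
    midpoint. *)
Lemma sigma_nonadj v w : e v w -> 0 < #|~: nbhd2 e v w| ->
  sigma v w = #|~: nbhd2 e v w| /\
  forall x, sigma_through v w x = (x \notin nbhd2 e v w).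
Proof.
move=> vw; have /andP[v_w v'w] := vw.
have -> : ~: nbhd2 e v w = [set y | adj v y && adj y w].
  by apply/setP=> y; rewrite mem_nbhd2C // inE.
case/card_gt0P=> y; rewrite inE => /andP[vy yw].
rewrite /sigma /sigma_through /geodesics (dist2 v_w v'w vy yw) paths2 //.
split=> [|x]; first by rewrite card_imset // => a b [].
rewrite -in_setC mem_nbhd2C //.
case: (boolP (adj v x && adj x w)) => [/andP[vx xw]|xN].
  transitivity #|[set [tuple x; w]]|; last by rewrite cards1.
  apply: eq_card => p; rewrite in_set1 inE.
  apply/andP/eqP => [[/imsetP[a _ ->]] /= /and3P[]|->].
    rewrite !inE => /or3P[] /eqP->; rewrite ?eqxx //.
  rewrite imset_f ?inE ?vx //= eqxx orbT /=.
  by rewrite eq_sym !adj_neq // adj_sym.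
apply/eqP; rewrite cards_eq0; apply/set0Pn => -[p].
rewrite inE => /andP[/imsetP[a]]; rewrite inE => aN -> /and3P[].
rewrite !inE => /or3P[] /eqP E; rewrite E ?eqxx //.
by rewrite E aN in xN.
Qed.

Lemma double_half_sum (F : G -> G -> rat) :
  (forall v w, F v w = F w v) -> (forall v, F v v = 0%R) ->
  (2%:R * (\sum_v \sum_(w | (enum_rank v < enum_rank w)%N) F v w) =
   \sum_v \sum_w F v w)%R.
Proof.
move=> Fsym F0.
have -> : (\sum_v \sum_w F v w =
    \sum_v (\sum_(w | (enum_rank v < enum_rank w)%N) F v w +
            \sum_(w | (enum_rank w < enum_rank v)%N) F v w))%R.
  apply: eq_bigr => v _.
  rewrite (bigID (fun w => enum_rank v < enum_rank w)) /=.
  congr (_ + _)%R; rewrite [LHS](bigD1 v) /= ?ltnn // F0 add0r.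
  apply: eq_bigl => w; rewrite -leqNgt ltn_neqAle andbC.
  by rewrite (inj_eq val_inj) (inj_eq enum_rank_inj).
rewrite big_split /= [X in (_ + X)%R](exchange_big_dep predT) //=.
rewrite mulr_natl mulr2n; congr (_ + _)%R.
by apply: eq_bigr => v _; apply: eq_bigr => w _; apply: Fsym.
Qed.

Hypothesis card_nbhd2C_gt0 : forall v w, e v w -> 0 < #|~: nbhd2 e v w|.

Lemma double_betweenness x :
  (2%:R * betweenness x =
   \sum_(q | e q.1 q.2 && (x \notin nbhd2 e q.1 q.2)) wt e q)%R.
Proof.
pose F v w := if e v w && (x \notin nbhd2 e v w) then wt e (v, w) else 0%R.
rewrite [RHS]big_mkcond -(pair_bigA _ F) /= -double_half_sum.
- congr (_ * _)%R; apply: eq_bigr => v _; apply: eq_bigr => w vw.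
  have v_w : v != w by apply: contraTneq vw => ->; rewrite ltnn.
  have [|vwN] := boolP (adj v w) => [vw'|].
    by rewrite sigma_through_adj // mul0r /F compl_adjN // vw'.
  have evw : e v w by rewrite compl_adjN.
  have [sE stE] := sigma_nonadj evw (card_nbhd2C_gt0 evw).
  rewrite sE stE /F evw /= /wt /=; case: ifP => _; first by rewrite mul1r.
  by rewrite mul0r.
- by move=> v w; rewrite /F /wt /= nbhd2C (compl_adj_sym v w : e v w = e w v).
- by move=> v; rewrite /F (compl_adj_irrefl v : e v v = false).
Qed.

(** Equal betweenness thereby turns into equal load, since the total weight does not depend on
    [x]. *)
Lemma double_betweenness_load x :
  (2%:R * betweenness x = \sum_(q | e q.1 q.2) wt e q - load e x)%R.
Proof.
rewrite double_betweenness.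
rewrite [X in (X - _)%R](bigID (fun q => x \in nbhd2 e q.1 q.2)) /=.
rewrite /load [X in (_ - X)%R](eq_bigl (fun q =>
  e q.1 q.2 && (x \in nbhd2 e q.1 q.2))).
  by rewrite addrC addrK.
by move=> q; rewrite inE.
Qed.

(** Each dart contributes its weight 1/(n - d) at the n - d vertices outside its [nbhd2], hence 1 in
    total. *)
Lemma sum_double_betweenness :
  (\sum_(x : G) 2%:R * betweenness x = (\sum_(x : G) #|nbhd e x|)%:R :> rat)%R.
Proof.
rewrite (eq_bigr _ (fun x _ => double_betweenness x)).
rewrite (exchange_big_dep (fun q : G * G => e q.1 q.2)) /=; last first.
  by move=> x q _ /andP[].
rewrite natr_sum (eq_bigr (fun v => \sum_(w | e v w) 1)%R) => [|v _];
  last first.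
  by rewrite sumr_const; congr (_%:R)%R; apply: eq_card => w; rewrite inE.
rewrite [RHS]pair_big_dep; apply: eq_bigr => q eq.
rewrite (eq_bigl (mem (~: nbhd2 e q.1 q.2))) => [|x]; last first.
  by rewrite /= in_setC eq.
rewrite sumr_const -mulr_natl divff // pnatr_eq0 -lt0n.
exact: card_nbhd2C_gt0.
Qed.

End Betweenness.

(** * Components that are stars *)

Section StarComponents.
Variable G : sgraph.
Implicit Types c x y z : G.

(** The centre is the preimage of [None]. Neighbours of component vertices stay in the component, so
    the neighbourhoods can be read in all of [G]. *)
Lemma star_center l x : isomorphic (component x) (star l) ->
  exists c, #|nbhd adj c| = l /\ forall y, adj c y -> nbhd adj y = [set c].
Proof.
case=> f [g fK gK] fadj; pose c := val (g None).
have xc : connect adj x c by apply: valP (g None).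
have adjg o (y : component x) : adj (val (g o)) (val y) = star_adj o (f y).
  by rewrite -[LHS]/(adj (g o) y) -fadj gK.
have lift_nbr (y : component x) z : adj (val y) z ->
    exists z' : component x, val z' = z.
  move=> yz; have xz : connect adj x z.
    exact: connect_trans (valP y) (connect1 yz).
  by exists (exist _ z xz).
exists c; split=> [|y cy].
  have -> : nbhd adj c = [set val (g (Some i)) | i : 'I_l].
    apply/setP=> y; rewrite inE; apply/idP/imsetP => [cy|[i _ ->]].
      have [y' y'E] := lift_nbr _ _ cy; move: cy; rewrite -y'E adjg.
      by case fy: (f y') => [i|] // _; exists i; rewrite // -fy fK.
    by rewrite adjg gK.
  rewrite card_imset ?card_ord // => i j /val_inj/(can_inj gK).
  by case.
have [y' y'E] := lift_nbr _ _ cy; move: cy; rewrite -y'E adjg.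
case fy: (f y') => [i|] // _; apply/setP=> z; rewrite !inE.
apply/idP/eqP => [yz|->].
  have [z' z'E] := lift_nbr _ _ yz; move: yz; rewrite -z'E.
  rewrite -[y']fK fy adjg; case fz: (f z') => [|] // _.
  by rewrite /c -fz fK.
by rewrite -[y']fK fy -/c adjg gK.
Qed.

Lemma component_star c x : (forall y, adj c y -> nbhd adj y = [set c]) ->
  x = c \/ adj c x -> isomorphic (component x) (star #|nbhd adj c|).
Proof.
move=> leaves cx; set S := nbhd adj c.
have adj_leaf y z : adj c y -> adj y z = (z == c).
  by move=> /leaves/setP/(_ z); rewrite !inE.
have xc : connect adj x c.
  by case: cx => [->|cx]; [apply: connect0|apply: connect1; rewrite adj_sym].
pose a := c |: S.
have ca : closed adj a.
  apply: intro_closed; first exact: sym_connect_sym (@adj_sym G).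
  move=> y z yz; rewrite !inE => /orP[/eqP<-|cy]; first by rewrite yz orbT.
  by rewrite -(adj_leaf y) // yz.
pose hv (o : option 'I_#|S|) := oapp enum_val c o.
have hvS i : adj c (hv (Some i)) by have := enum_valP i; rewrite inE.
have xhv o : connect adj x (hv o).
  by apply: connect_trans xc _; case: o => [i|] //; apply: connect1.
pose h (o : star #|S|) : component x := exist _ (hv o) (xhv o).
have hadj o1 o2 : adj (h o1) (h o2) = adj o1 o2.
  rewrite -[LHS]/(adj (hv o1) (hv o2)); case: o1 o2 => [i|] [j|].
  - rewrite adj_leaf //; apply: contraTF (hvS j) => /eqP->.
    by rewrite adj_irrefl.
  - by rewrite adj_sym hvS.
  - exact: hvS.
  - exact: adj_irrefl.
have hinj : injective h.
  move=> o1 o2 /(congr1 val) /= E; move: (hvS); move: E.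
  case: o1 o2 => [i|] [j|] //= E hS.
  - by rewrite (enum_val_inj E).
  - by have := hS i; rewrite /= E adj_irrefl.
  - by have := hS j; rewrite /= -E adj_irrefl.
(* The closed set [a] contains the component, so the injection [h] is onto by cardinality. *)
have [|k hK kK] := inj_card_bij hinj.
  rewrite card_option card_ord card_sig.
  apply: leq_trans (_ : #|a| <= _); last first.
    by rewrite cardsU1; case: (_ \notin _).
  apply/subset_leq_card/subsetP=> y; rewrite inE => xy.
  rewrite -(closed_connect ca xy) !inE.
  by case: cx => [->|->]; rewrite ?eqxx ?orbT.
exists k; first by exists h.
by move=> y z; rewrite -hadj !kK.
Qed.

End StarComponents.

Theorem lemma32 (H : sgraph) :
  exotic_coBUG H -> ~ (exists x : H, isomorphic (component x) (star 7)).
Proof.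
case=> G [[[Gconn Bconst] Blow] exoG] [h hbij hadj].
case=> x0 /star_center[c0 [c07 c0leaf]].
apply: exoG; have [g hK gK] := hbij.
pose e : rel G := @compl_adj G; pose c : G := h c0.
have esym : symmetric e := @compl_adj_sym G.
have eirr : irreflexive e := @compl_adj_irrefl G.
have nbhdE x : nbhd e (h x) = h @: nbhd adj x.
  apply/setP=> y; rewrite -[y]gK mem_imset; last exact: can_inj hK.
  by rewrite !inE -hadj.
have c7 : #|nbhd e c| = 7 by rewrite nbhdE card_imset //; apply: can_inj hK.
have cleaf y : e c y -> nbhd e y = [set c].
  rewrite -[y]gK => cy; rewrite nbhdE c0leaf ?imset_set1 //.
  by rewrite -hadj.
have [l cl] : exists l, e c l.
  have : 0 < #|nbhd e c| by rewrite c7.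
  by case/card_gt0P=> l; rewrite inE; exists l.
(* [G] is connected and [c] differs from [l], so a path from [c] to [l] has a first edge; its end
   [z] lies outside the star of [c]. *)
have [z cz] : exists z, @adj G c z.
  have /connectP[[|z p] /=] := Gconn c l.
    by move=> _ E; rewrite E eirr in cl.
  by case/andP; exists z.
have zN : z \notin c |: nbhd e c.
  rewrite !inE negb_or eq_sym (adj_neq cz) /=.
  by rewrite /e /compl_adj cz andbF.
(* An edge in the star of [c] leaves [z] uncovered, and any other edge leaves [c] uncovered. *)
have card_gt0 v w : e v w -> 0 < #|~: nbhd2 e v w|.
  have cN u u' : e c u -> e u u' -> 0 < #|~: nbhd2 e u u'|.
    move=> cu uu'; have u'c : u' = c.
      by apply/eqP; have /setP/(_ u') := cleaf u cu; rewrite !inE uu' => <-.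
    by apply/card_gt0P; exists z; rewrite inE u'c /nbhd2 cleaf.
  move=> vw; have [cv|cv] := boolP (e c v); first exact: cN.
  have [cw|cw] := boolP (e c w); first by rewrite nbhd2C cN // esym.
  by apply/card_gt0P; exists c; rewrite !inE esym (negbTE cv) esym (negbTE cw).
have load_const x y : load e x = load e y.
  have := double_betweenness_load card_gt0 x.
  have := double_betweenness_load card_gt0 y.
  by rewrite (Bconst x y) => -> /addrI/oppr_inj.
(* The dart count is the sum of the doubled betweennesses, each below 2. *)
have few : \sum_(x : G) #|nbhd e x| < 2 * #|G|.
  rewrite -(ltr_nat rat) -(sum_double_betweenness card_gt0).
  rewrite mulnC natrM mulr_natl -sumr_const.
  apply: ltr_sum => [|x _].
    by apply/hasP; exists c; rewrite ?mem_index_enum.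
  by have := Blow x; lra.
exists 7 => x.
have [d [d7 dleaf xd]] :=
  star_cover esym eirr card_gt0 load_const (cleaf l cl) c7 few x.
by rewrite -d7; apply: (@component_star (compl G)).
Qed.
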